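(* Let $n\geq 1$, let $k_i>0$ (not necessarily integers) and $p_i\in(0,1)$ for $i=1,\ldots,n$, let $p\in(0,1)$, and let $k_+=\sum_{i=1}^nk_i$. Let $N=\sum_{i=1}^nN_i$, where $N_1,\ldots,N_n$ are independent with $N_i\sim\mathrm{NB}(k_i,p_i)$, and let $M\sim\mathrm{NB}(k_+,p)$. Then: 1. $M\leq_{st}N$ if and only if $p\geq\left(\prod_{i=1}^np_i^{k_i}\right)^{1/k_+}$; likewise, $M\leq_{hr}N$ if and only if $p\geq\left(\prod_{i=1}^np_i^{k_i}\right)^{1/k_+}$. 2. $M\leq_{lr}N$ if and only if $p\geq\sum_{i=1}^nk_ip_i/k_+$; likewise, $M\leq_{rh}N$ if and only if $p\geq\sum_{i=1}^nk_ip_i/k_+$.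
   Context: $\mathrm{NB}(k,p)$ ($k>0$ real, $0<p<1$) is the negative binomial distribution with pmf $\binom{k+x-1}{x}p^k(1-p)^x$, $x=0,1,2,\ldots$, where $\binom{k+x-1}{x}=\frac{\Gamma(k+x)}{\Gamma(k)\,x!}$. Let $X,Y$ have pmfs $f,g$ supported on $\mathbf{Z}_+=\{0,1,\ldots\}$ and cumulative distribution functions $F,G$, and put $\bar F(x)=1-F(x)$, $\bar G(x)=1-G(x)$. Usual stochastic order: $X\leq_{st}Y$ if $\bar F(x)\leq\bar G(x)$ for all $x$. Hazard rate order: $X\leq_{hr}Y$ if $f(x)/\bar F(x)\geq g(x)/\bar G(x)$ for all $x\in\mathbf{Z}_+$. Reversed hazard rate order: $X\leq_{rh}Y$ if $f(x)/F(x)\leq g(x)/G(x)$ for all $x\in\mathbf{Z}_+$. Likelihood ratio order: $X\leq_{lr}Y$ if $f(x)/g(x)$ is a monotone decreasing (i.e. non-increasing) function on $\mathbf{Z}_+$. *)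

(* Defs.v *)
From HB Require Import structures.
From mathcomp Require Import all_boot all_order all_algebra.
From mathcomp Require Import all_classical all_reals all_analysis.
From mathcomp Require Import measurable_realfun.

Set Implicit Arguments.
Unset Strict Implicit.
Unset Printing Implicit Defensive.

Import Order.TTheory GRing.Theory Num.Theory.
Import numFieldNormedType.Exports.

Local Open Scope classical_set_scope.
Local Open Scope ring_scope.

(* Euler's integral, meant for [0 < a]; it converges there, so that the real-
   valued [\int] loses nothing. *)
Definition Gamma {R : realType} (a : R) : R :=
  \int[@lebesgue_measure R]_(t in `]0, +oo[) (t `^ (a - 1) * expR (- t)).

(* The binomial coefficient "k + x - 1 choose x" for a real [k > 0]. *)
Definition nbinom_coef {R : realType} (k : R) (x : nat) : R :=
  Gamma (k + x%:R) / (Gamma k * x`!%:R).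

Definition nbinom_pmf {R : realType} (k p : R) (x : nat) : R :=
  nbinom_coef k x * p `^ k * (1 - p) ^+ x.

Definition nbinom_prob {R : realType} (k p : R) (U : set nat) : \bar R :=
  \esum_(x in U) (nbinom_pmf k p x)%:E.

(* Integer-valued variables are represented as real random variables, for which
   [pmf], [cdf] and [ccdf] are available; the law on [nat] is transported along
   the embedding [x |-> x%:R]. In particular [X] is almost surely in [nat]. *)
Definition nbinom_law d (T : measurableType d) (R : realType)
    (P : probability T R) (X : {RV P >-> R}) (k p : R) : Prop :=
  forall A : set R, measurable A ->
    distribution P X A = nbinom_prob k p [set x : nat | A x%:R].

Definition mutually_independent d (T : measurableType d) (R : realType)
    (P : probability T R) (I : finType) (X : I -> {RV P >-> R}) : Prop :=
  forall (J : {set I}) (A : I -> set R), (forall i, measurable (A i)) ->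
    P (\bigcap_(i in [set` J]) (X i @^-1` A i)) =
    (\prod_(i in J) P (X i @^-1` A i))%E.

(* The orders below compare the laws of two variables that may live on different
   sample spaces, and are meant for variables with values in [nat]. The last
   three involve quotients, which are genuine when both laws charge every
   natural number (otherwise [r / 0 = 0] applies). [ccdf] is [1 - cdf]. *)
Section stochastic_orders.
Context d d' (T : measurableType d) (T' : measurableType d') (R : realType).
Context (P : probability T R) (P' : probability T' R).
Variables (X : {RV P >-> R}) (Y : {RV P' >-> R}).

Definition st_le : Prop := forall x : R, (ccdf X x <= ccdf Y x)%E.

Definition hr_le : Prop := forall x : nat,
  pmf Y x%:R / fine (ccdf Y x%:R) <= pmf X x%:R / fine (ccdf X x%:R).

Definition rh_le : Prop := forall x : nat,
  pmf X x%:R / fine (cdf X x%:R) <= pmf Y x%:R / fine (cdf Y x%:R).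

Definition lr_le : Prop := forall x y : nat, (x <= y)%N ->
  pmf X y%:R / pmf Y y%:R <= pmf X x%:R / pmf Y x%:R.

End stochastic_orders.

(* Main.v *)
Require Import Defs.
From HB Require Import structures.
From mathcomp Require Import all_boot all_order all_algebra.
From mathcomp Require Import all_classical all_reals all_analysis.
From mathcomp Require Import measurable_realfun.
From mathcomp Require Import ring lra.

Set Implicit Arguments.
Unset Strict Implicit.
Unset Printing Implicit Defensive.

Import Order.TTheory GRing.Theory Num.Theory.
Import numFieldNormedType.Exports.

Local Open Scope classical_set_scope.
Local Open Scope ring_scope.

(** Write f and g for the mass functions of M and N, K for the sum of the k_i and
s_i = 1 - q_i. The whole theorem rests on one fact: the ratio f / g is
log-concave.

With such a ratio each order is decided at the origin. A positive log-concave
sequence is unimodal, so that f / g first increases, then decreases. If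
f 0 >= g 0, it can pass below 1 only while decreasing, hence f - g changes sign at
most once, from plus to minus, which yields the usual and the hazard rate orders
([st_iff_mass0], [hr_iff_mass0]); if it starts by decreasing, it decreases
throughout, which is the likelihood ratio order and implies the reversed hazard
rate order ([lr_iff_ratio01], [rh_iff_ratio01]). Conversely each order, read at 0
or at 1, gives back the condition at the origin. Now f 0 = p^K and g 0 is the
product of the q_i^k_i, while f 1 / f 0 = K (1 - p) and g 1 / g 0 is the sum of
the k_i s_i: these are the two conditions of the theorem.

For the log-concavity, g x is, up to the factor g 0, the coefficient h_x of X^x in
the product of the series (1 - s_i X)^(-k_i), and f x is, up to the factor f 0,
(1 - p)^x times the coefficient of X^x in (1 - X)^(-K). The quotient of h_x by
the latter coefficient is the moment of order x of S = sum_i s_i D_i, where D is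
a Dirichlet vector of parameter k. Moments of a nonnegative variable are
log-convex by the Cauchy-Schwarz inequality, and dividing a geometric sequence by
them gives a log-concave sequence. No Dirichlet integral is ever formed: the
moments are defined as the quotients above, and differentiating the product of
series gives a recurrence which expresses the moment of order x + 1 as a positive
combination of moments of order x for the parameters k + e_i
([dirichlet_momentS]). It propagates the positivity of the quadratic form
E(S^x (a + b S)^2) from x = 0 to all x ([dirichlet_moment_quadratic]), and
log-convexity is the negativity of the discriminant.

On the probabilistic side, the recurrence of the Gamma function ([GammaS]) turns
the negative binomial coefficients into rising factorials, and independence
expresses g as a sum over multi-indices ([pmf_sum]), which is the coefficient of
the product of series ([nbinom_convE]). *)

(** * Orderings of mass functions with a log-concave ratio *)

Definition partial_sum {V : nmodType} (f : nat -> V) (n : nat) : V :=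
  \sum_(j < n) f j.

Definition log_concave {R : realFieldType} (r : nat -> R) : Prop :=
  forall x, r x * r x.+2 <= r x.+1 ^+ 2.

Section log_concave_sequences.
Context {R : realFieldType}.
Variable r : nat -> R.
Hypotheses (r_gt0 : forall x, 0 < r x) (r_lc : log_concave r).

(** Log-concavity says that successive quotients [r x.+1 / r x] decrease: once one
of them is at most 1, all later ones are. *)
Lemma log_concave_nonincreasing_from x : r x.+1 <= r x ->
  forall y z, (x <= y)%N -> (y <= z)%N -> r z <= r y.
Proof.
move=> rx.
have step i : r (x + i).+1 <= r (x + i)%N.
  elim: i => [|i IHi]; first by rewrite addn0.
  rewrite addnS -(ler_pM2l (r_gt0 (x + i)%N)); apply: le_trans (r_lc _) _.
  by rewrite expr2 ler_pM2r.
move=> y z xy /subnK <-; elim: (z - y)%N => // m; apply: le_trans.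
rewrite addSn; have /subnKC <- : (x <= m + y)%N by rewrite (leq_trans xy)// leq_addl.
exact: step.
Qed.

(** Dually, a successive quotient that is at least 1 forces all the earlier ones
to be at least 1. Together with the previous lemma, this makes [r] unimodal. *)
Lemma log_concave_nondecreasing_until x : r x <= r x.+1 ->
  forall y, (y <= x)%N -> r y <= r x.
Proof.
elim: x => [_ y|x IHx rx y]; first by rewrite leqn0 => /eqP->.
have rx' : r x <= r x.+1.
  rewrite -(ler_pM2r (r_gt0 x.+1)) -expr2; apply: le_trans (r_lc x).
  by rewrite ler_pM2l.
rewrite leq_eqVlt => /predU1P[->//|]; rewrite ltnS => /(IHx rx') /le_trans; exact.
Qed.

End log_concave_sequences.

Section orders_from_log_concavity.
Context {R : realType}.
Variables f g : nat -> R.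
Hypotheses (f_gt0 : forall x, 0 < f x) (g_gt0 : forall x, 0 < g x).
Hypotheses (f_sum1 : partial_sum f @ \oo --> (1 : R))
           (g_sum1 : partial_sum g @ \oo --> (1 : R)).
Let r x := f x / g x.
Hypothesis r_lc : log_concave r.

Let r_gt0 x : 0 < r x. Proof. exact: divr_gt0. Qed.

Let f_eq x : f x = r x * g x. Proof. by rewrite /r divfK// gt_eqF. Qed.

Lemma partial_sumS (h : nat -> R) n :
  partial_sum h n.+1 = partial_sum h n + h n.
Proof. exact: big_ord_recr. Qed.

Lemma partial_sum_lt1 (h : nat -> R) n : (forall x, 0 < h x) ->
  partial_sum h @ \oo --> (1 : R) -> partial_sum h n < 1.
Proof.
move=> h0 h1.
have nd : nondecreasing_seq (partial_sum h).
  by apply/nondecreasing_seqP => m; rewrite partial_sumS lerDl ltW.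
have := nondecreasing_cvgn_le nd (cvgP _ h1) n.+1.
by rewrite (cvg_lim _ h1)//; apply: lt_le_trans; rewrite partial_sumS ltrDl.
Qed.

(** Passage from finite sums to infinite tails: [1 - partial_sum h n] is the limit
of the sums of [h] over [n <= y < m] as [m] grows. *)
Lemma tail_le_scaled c n : (forall y, (n <= y)%N -> f y <= c * g y) ->
  1 - partial_sum f n <= c * (1 - partial_sum g n).
Proof.
move=> fcg.
have cf : partial_sum f x - partial_sum f n @[x --> \oo] --> 1 - partial_sum f n.
  by apply: cvgB => //; exact: cvg_cst.
have cg : c * (partial_sum g x - partial_sum g n) @[x --> \oo] -->
          c * (1 - partial_sum g n).
  by apply: cvgMl_tmp; apply: cvgB => //; exact: cvg_cst.
apply: ler_cvg_to cf cg _; exists n => //= m /= /subnK <-.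
elim: (m - n)%N => [|i IHi]; first by rewrite !subrr mulr0.
rewrite addSn !partial_sumS -!(addrAC _ (- _)) mulrDr lerD//.
by rewrite fcg// leq_addl.
Qed.

(** If [f] lagged behind [g] at [n], then [r] would be below 1 somewhere before
[n]. As it starts at least at 1, it must be decreasing by then, so [f < g]
throughout the tail from [n] on; but both masses total 1, so the tail of [f] has
to be the larger one. *)
Lemma st_dominance : g 0%N <= f 0%N ->
  forall n, partial_sum g n <= partial_sum f n.
Proof.
move=> gf0 n; rewrite leNgt; apply/negP => FG.
have r0 : 1 <= r 0%N by rewrite ler_pdivlMr// mul1r.
have [j jn fgj] : exists2 j, (j < n)%N & r j < 1.
  apply: contrapT => H; move: FG; apply/negP; rewrite -leNgt.
  apply: ler_sum => i _; rewrite leNgt; apply/negP => fg; apply: H.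
  by exists (nat_of_ord i) => //; rewrite ltr_pdivrMr// mul1r.
have : 1 - partial_sum f n <= 1 * (1 - partial_sum g n).
  apply: tail_le_scaled => y ny; rewrite f_eq ler_pM2r//.
  rewrite (le_trans _ (ltW fgj))//.
  have [rj|/ltW rj] := leP (r j.+1) (r j); last first.
    have /(_ 0%N isT) := log_concave_nondecreasing_until r_gt0 r_lc rj.
    by move=> /(le_trans r0); rewrite leNgt fgj.
  apply: (log_concave_nonincreasing_from r_gt0 r_lc rj) => //.
  by rewrite (leq_trans _ ny)// ltnW.
by rewrite mul1r lerD2l lerN2 leNgt FG.
Qed.

Lemma st_iff_mass0 :
  (forall n, partial_sum g n <= partial_sum f n) <-> g 0%N <= f 0%N.
Proof.
split; last exact: st_dominance.
by move=> /(_ 1%N); rewrite /partial_sum !big_ord_recl !big_ord0 !addr0.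
Qed.

(** Either [r] has stopped increasing at [x], and then [f y <= r x * g y] over the
tail gives the bound; or [r] is still increasing, hence [r x >= r 0 >= 1], and the
bound follows from the stochastic comparison of the two tails. Conversely, at
[x = 0] the hazard rate is [h 0 / (1 - h 0)], which increases with [h 0]. *)
Lemma hr_iff_mass0 :
  (forall x, g x / (1 - partial_sum g x.+1) <= f x / (1 - partial_sum f x.+1))
  <-> g 0%N <= f 0%N.
Proof.
have tf x : 0 < 1 - partial_sum f x by rewrite subr_gt0 partial_sum_lt1.
have tg x : 0 < 1 - partial_sum g x by rewrite subr_gt0 partial_sum_lt1.
split=> [/(_ 0%N)|gf0 x]; rewrite ler_pdivrMr// mulrAC ler_pdivlMr//.
  rewrite /partial_sum !big_ord_recl !big_ord0 !addr0.
  by rewrite !mulrBr !mulr1 (mulrC (f _)) lerD2r.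
rewrite f_eq mulrAC mulrC ler_pM2r//.
have [rx|/ltW rx] := leP (r x.+1) (r x).
  apply: tail_le_scaled => y xy; rewrite f_eq ler_pM2r//.
  by apply: (log_concave_nonincreasing_from r_gt0 r_lc rx) => //; exact: ltnW.
have rx1 : 1 <= r x.
  apply: le_trans (log_concave_nondecreasing_until r_gt0 r_lc rx (leq0n x)).
  by rewrite ler_pdivlMr// mul1r.
apply: (@le_trans _ _ (1 - partial_sum g x.+1)).
  by rewrite lerD2l lerN2 st_dominance.
by rewrite ler_peMl// ltW.
Qed.

Lemma lr_iff_ratio01 :
  (forall x y, (x <= y)%N -> r y <= r x) <-> r 1%N <= r 0%N.
Proof.
split=> [/(_ 0%N 1%N)|r10 x y xy]; first exact.
exact: (log_concave_nonincreasing_from r_gt0 r_lc r10).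
Qed.

(** The likelihood ratio order gives [f x * g j <= g x * f j] for [j <= x], to be
summed over [j]. Conversely, the reversed hazard rate at 1 is
[h 1 / (h 0 + h 1)], which increases with [h 1 / h 0]. *)
Lemma rh_iff_ratio01 :
  (forall x, f x / partial_sum f x.+1 <= g x / partial_sum g x.+1)
  <-> r 1%N <= r 0%N.
Proof.
have psum_gt0 (h : nat -> R) x : (forall x, 0 < h x) -> 0 < partial_sum h x.+1.
  by move=> h0; rewrite /partial_sum big_ord_recl ltr_wpDr// sumr_ge0// => i _; exact: ltW.
split=> [/(_ 1%N)|r10 x]; rewrite ler_pdivrMr ?psum_gt0// mulrAC ler_pdivlMr ?psum_gt0//.
  rewrite /partial_sum !big_ord_recl !big_ord0 !addr0/= !mulrDr (mulrC (g _) (f 1%N)) lerD2r.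
  by rewrite /r ler_pdivrMr// mulrAC ler_pdivlMr// [in X in _ -> X]mulrC [in X in _ -> X](mulrC (f 0%N))
   mulrC.
rewrite f_eq -mulrA mulrC -mulrA ler_pM2l// mulrC /partial_sum mulr_sumr.
apply: ler_sum => i _; rewrite f_eq ler_pM2r//.
have ix : (i <= x)%N by rewrite -ltnS.
exact: (log_concave_nonincreasing_from r_gt0 r_lc r10).
Qed.

End orders_from_log_concavity.

(** * Coefficients of products of binomial series *)

(** The Pochhammer symbol, equal to [Gamma (k + x) / Gamma k]. *)
Definition rising {R : realFieldType} (k : R) (x : nat) : R :=
  \prod_(j < x) (k + j%:R).

(** The binomial series of (1 - s X)^(-k), truncated below degree [m]. *)
Definition nbinom_poly {R : realFieldType} (k s : R) (m : nat) : {poly R} :=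
  \poly_(j < m) (rising k j / j`!%:R * s ^+ j).

(** The coefficient of X^x in the product over [i] of the power series
(1 - s_i X)^(-k_i). Truncating each factor below degree [x.+1] does not affect
that coefficient, and keeps the product polynomial. *)
Definition nbinom_conv {R : realFieldType} {n} (k s : 'I_n -> R) (x : nat) : R :=
  (\prod_i nbinom_poly (k i) (s i) x.+1)`_x.

(** The moment of order [x] of the random variable sum_i s_i D_i, where D follows
the Dirichlet distribution with parameters [k]: averaging (1 - S X)^(-K) over
S = sum_i s_i D_i, with K = sum_i k_i, gives the product of the series
(1 - s_i X)^(-k_i), and the two expansions are compared coefficientwise. *)
Definition dirichlet_moment {R : realFieldType} {n} (k s : 'I_n -> R) (x : nat) : R :=
  nbinom_conv k s x / (rising (\sum_i k i) x / x`!%:R).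

Definition shift_at {R : realFieldType} {n} (k : 'I_n -> R) (i : 'I_n) : 'I_n -> R :=
  fun j => k j + (j == i)%:R.

Section rising_factorial.
Context {R : realFieldType}.
Implicit Types k s : R.

Lemma rising0 k : rising k 0 = 1. Proof. exact: big_ord0. Qed.

Lemma risingS k x : rising k x.+1 = rising k x * (k + x%:R).
Proof. exact: big_ord_recr. Qed.

Lemma risingSl k x : rising k x.+1 = k * rising (k + 1) x.
Proof.
rewrite /rising big_ord_recl addr0; congr (_ * _); apply: eq_bigr => j _.
by rewrite -addrA -[1]/(1%:R) -natrD.
Qed.

Lemma rising_gt0 k x : 0 < k -> 0 < rising k x.
Proof. by move=> k0; apply: prodr_gt0 => j _; rewrite ltr_wpDr. Qed.

Lemma fact_neq0 (x : nat) : x`!%:R != 0 :> R.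
Proof. by rewrite pnatr_eq0 -lt0n fact_gt0. Qed.

End rising_factorial.

(** The truncation order of the factors is immaterial as long as it exceeds the
index of the coefficient: what makes truncated series usable as power series. *)
Lemma coef_prod_agree {R : comNzRingType} (I : finType) (P Q : I -> {poly R}) x :
  (forall i j, (j <= x)%N -> (P i)`_j = (Q i)`_j) ->
  (\prod_i P i)`_x = (\prod_i Q i)`_x.
Proof.
move=> PQ.
suff : forall j, (j <= x)%N -> (\prod_i P i)`_j = (\prod_i Q i)`_j by apply.
apply: (big_ind2 (fun p q : {poly R} => forall j, (j <= x)%N -> p`_j = q`_j)) => //; last first.
  by move=> i _ j; exact: PQ.
move=> p1 q1 p2 q2 pq1 pq2 j jx; rewrite !coefM; apply: eq_bigr => i _.
by rewrite pq1 ?pq2 ?(leq_trans _ jx) ?leq_subr// -ltnS.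
Qed.

Lemma deriv_prod_seq {R : comNzRingType} (I : eqType) (s : seq I) (P : I -> {poly R}) :
  uniq s -> (\prod_(i <- s) P i)^`() =
  \sum_(i <- s) \prod_(j <- s) (if j == i then (P j)^`() else P j).
Proof.
elim: s => [_|a s IHs /= /andP[as_ us]]; first by rewrite !big_nil derivC.
rewrite !big_cons derivM IHs// eqxx; congr (_ * _ + _).
  by apply: eq_big_seq => j js; case: eqP => // ja; rewrite -ja js in as_.
rewrite mulr_sumr; apply: eq_big_seq => i is_; rewrite big_cons.
by case: eqP => // ai; rewrite ai is_ in as_.
Qed.

Section dirichlet_moments.
Context {R : realFieldType} {n : nat}.
Implicit Types k s : 'I_n -> R.

Lemma sum_shift_at k i : \sum_j shift_at k i j = \sum_j k j + 1.
Proof.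
rewrite big_split/=; congr (_ + _).
by rewrite (bigD1 i)//= eqxx big1 ?addr0// => j /negbTE->.
Qed.

(** Coefficient of X^x in the derivative of the product: differentiating
(1 - s_i X)^(-k_i) yields k_i s_i (1 - s_i X)^(-(k_i + 1)). *)
Lemma nbinom_convS k s x : x.+1%:R * nbinom_conv k s x.+1 =
  \sum_i k i * s i * nbinom_conv (shift_at k i) s x.
Proof.
rewrite /nbinom_conv mulr_natl -coef_deriv deriv_prod_seq ?index_enum_uniq//.
rewrite coef_sum; apply: eq_bigr => i _; rewrite -coefZ.
transitivity (\prod_j ((if j == i then k j * s j else 1) *:
   nbinom_poly (shift_at k i j) (s j) x.+1))`_x.
  apply: coef_prod_agree => j y yx.
  rewrite coefZ coef_poly ltnS yx /shift_at; case: eqP => [_|_]; last first.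
    by rewrite mul1r addr0 coef_poly ltnS (leq_trans yx).
  rewrite coef_deriv coef_poly !ltnS yx risingSl factS natrM exprS.
  by rewrite -mulr_natr; field; rewrite fact_neq0 nat1r pnatr_eq0.
by rewrite scaler_prod -big_mkcond big_pred1_eq.
Qed.

Lemma nbinom_conv0 k s : nbinom_conv k s 0 = 1.
Proof.
rewrite /nbinom_conv; under eq_bigr => i _.
  rewrite /nbinom_poly poly_def big_ord_recl big_ord0 rising0 fact0 expr0.
  rewrite invr1 !mulr1 addr0 scale1r; over.
by rewrite big1// coef1.
Qed.

Lemma dirichlet_moment0 k s : dirichlet_moment k s 0 = 1.
Proof. by rewrite /dirichlet_moment nbinom_conv0 rising0 fact0 !divr1. Qed.

(** Size-biasing of the Dirichlet distribution: weighting by D_i turns the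
parameter [k] into [shift_at k i], at the price of the factor k_i / K. Here
[x.+1] is the exponent of S^x * sum_i s_i D_i. *)
Lemma dirichlet_momentS k s x : 0 < \sum_i k i ->
  dirichlet_moment k s x.+1 =
  \sum_i k i / (\sum_j k j) * s i * dirichlet_moment (shift_at k i) s x.
Proof.
move=> K0; set K := \sum_i k i.
have x1 : x.+1%:R != 0 :> R by rewrite pnatr_eq0.
have Rx : rising (K + 1) x != 0 by rewrite gt_eqF// rising_gt0// addr_gt0.
rewrite {1}/dirichlet_moment -[nbinom_conv _ _ _](mulKf x1) nbinom_convS.
rewrite mulrC !mulr_sumr; apply: eq_bigr => i _.
rewrite /dirichlet_moment sum_shift_at -/K risingSl factS natrM.
by field; rewrite fact_neq0 Rx nat1r x1 gt_eqF.
Qed.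

Lemma shift_at_gt0 k i : (forall j, 0 < k j) -> forall j, 0 < shift_at k i j.
Proof. by move=> k0 j; rewrite /shift_at ltr_wpDr. Qed.

Lemma sum_gt0 k : (0 < n)%N -> (forall j, 0 < k j) -> 0 < \sum_i k i.
Proof.
move=> n0 k0; rewrite (bigD1 (Ordinal n0))//= ltr_wpDr// sumr_ge0// => i _.
exact: ltW.
Qed.

Lemma dirichlet_moment1 k s : 0 < \sum_i k i ->
  dirichlet_moment k s 1 = (\sum_i k i * s i) / \sum_i k i.
Proof.
move=> K0; rewrite dirichlet_momentS// mulr_suml; apply: eq_bigr => i _.
by rewrite dirichlet_moment0 mulr1 mulrAC.
Qed.

Lemma dirichlet_moment_gt0 k s x : (0 < n)%N ->
  (forall i, 0 < k i) -> (forall i, 0 < s i) -> 0 < dirichlet_moment k s x.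
Proof.
move=> n0 k0 s0; elim: x k k0 => [|x IHx] k k0.
  by rewrite dirichlet_moment0.
rewrite dirichlet_momentS; last exact: sum_gt0.
apply: (@sum_gt0 (fun i => _) n0) => i.
apply: mulr_gt0; last by apply: IHx; exact: shift_at_gt0.
by rewrite mulr_gt0 ?divr_gt0 ?sum_gt0.
Qed.

(** The quadratic form is the expectation of S^x * (a + b S)^2. Moments are
available only through their recurrence, so positivity is proved by induction on
[x], for all parameters at once: the recurrence lowers the exponent and writes
the form as a positive combination of forms of the same kind with shifted
parameters. *)
Lemma dirichlet_moment_quadratic k s (a b : R) x : (0 < n)%N ->
  (forall i, 0 < k i) -> (forall i, 0 < s i) ->
  0 <= a ^+ 2 * dirichlet_moment k s x
     + 2 * a * b * dirichlet_moment k s x.+1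
     + b ^+ 2 * dirichlet_moment k s x.+2.
Proof.
move=> n0 k0 s0; elim: x k k0 => [|x IHx] k k0.
  have K0 := sum_gt0 n0 k0.
  rewrite dirichlet_moment0 dirichlet_moment1//.
  set K := \sum_i k i; set S := \sum_i k i * s i.
  have -> : dirichlet_moment k s 2 =
      (S ^+ 2 + \sum_i k i * s i ^+ 2) / (K * (K + 1)).
    rewrite dirichlet_momentS// -/K expr2 mulr_suml -big_split mulr_suml.
    apply: eq_bigr => i _; rewrite dirichlet_moment1 ?sum_shift_at ?addr_gt0//.
    rewrite -/K /shift_at; under eq_bigr do rewrite mulrDl.
    rewrite big_split/= -/S (bigD1 i)//= eqxx mul1r big1; last first.
      by move=> j /negbTE ->; rewrite mul0r.
    by field; rewrite !gt_eqF ?addr_gt0.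
  (* The second moment (S^2 + sum_i k_i s_i^2) / (K (K + 1)) makes the form a sum
     of squares; this is where the Cauchy-Schwarz inequality hides. *)
  have -> : a ^+ 2 * 1 + 2 * a * b * (S / K) +
      b ^+ 2 * ((S ^+ 2 + \sum_i k i * s i ^+ 2) / (K * (K + 1))) =
      ((a * K + b * S) ^+ 2 + \sum_i k i * (a + b * s i) ^+ 2)
      / (K * (K + 1)).
    have -> : \sum_i k i * (a + b * s i) ^+ 2 =
        a ^+ 2 * K + 2 * a * b * S + b ^+ 2 * \sum_i k i * s i ^+ 2.
      rewrite !mulr_sumr -!big_split; apply: eq_bigr => i _ /=; ring.
    by field; rewrite !gt_eqF ?addr_gt0.
  apply: divr_ge0; last by rewrite mulr_ge0 ?addr_ge0// ltW.
  apply: addr_ge0; first exact: sqr_ge0.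
  by apply: sumr_ge0 => i _; rewrite mulr_ge0 ?sqr_ge0// ltW.
rewrite !(dirichlet_momentS s _ (sum_gt0 n0 k0)) !mulr_sumr -!big_split.
apply: sumr_ge0 => i _ /=.
set c := k i / _ * _.
have c0 : 0 <= c by rewrite mulr_ge0 ?divr_ge0 ?ltW// sum_gt0.
have := mulr_ge0 c0 (IHx _ (shift_at_gt0 i k0)).
by rewrite !mulrDr !(mulrCA c).
Qed.

(** Negative discriminant of the quadratic form above, read off at the point
[a = w], [b = - v], where the form equals [w * (u * w - v ^+ 2)]. *)
Lemma dirichlet_moment_log_convex k s x : (0 < n)%N ->
  (forall i, 0 < k i) -> (forall i, 0 < s i) ->
  dirichlet_moment k s x.+1 ^+ 2 <=
  dirichlet_moment k s x * dirichlet_moment k s x.+2.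
Proof.
move=> n0 k0 s0.
have U2 := dirichlet_moment_gt0 x.+2 n0 k0 s0.
have := dirichlet_moment_quadratic (dirichlet_moment k s x.+2)
  (- dirichlet_moment k s x.+1) x n0 k0 s0.
set u := dirichlet_moment k s x; set v := dirichlet_moment k s x.+1.
set w := dirichlet_moment k s x.+2.
have -> : w ^+ 2 * u + 2 * w * - v * v + (- v) ^+ 2 * w = w * (u * w - v ^+ 2).
  by ring.
by rewrite pmulr_rge0// subr_ge0.
Qed.

End dirichlet_moments.

(** The explicit multi-index sum, in which the law of a sum of independent
variables appears. *)
Lemma nbinom_convE (R : realFieldType) n (k s : 'I_n -> R) x :
  nbinom_conv k s x = \sum_(t : {ffun 'I_n -> 'I_x.+1} | (\sum_i t i)%N == x)
    \prod_i (rising (k i) (t i) / (t i)`!%:R * s i ^+ t i).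
Proof.
rewrite /nbinom_conv.
under eq_bigr do rewrite /nbinom_poly poly_def.
rewrite bigA_distr_bigA coef_sum [RHS]big_mkcond; apply: eq_bigr => /= t _.
rewrite scaler_prod -expr_sum coefZ coefXn eq_sym.
by case: eqP => _; rewrite ?mulr1 ?mulr0.
Qed.

Section pmf_ratio.
Context {R : realFieldType} {n : nat}.
Variables (k s : 'I_n -> R) (c a : R).
Hypotheses (n_gt0 : (0 < n)%N) (k_gt0 : forall i, 0 < k i)
  (s_gt0 : forall i, 0 < s i) (c_gt0 : 0 < c) (a_gt0 : 0 < a).

(** Up to a positive factor, the ratio of the negative binomial mass function to
that of the sum: the rising factorials cancel, and a geometric sequence does not
affect log-concavity. *)
Lemma geometric_div_moment_log_concave :
  log_concave (fun x => c * (a ^+ x / dirichlet_moment k s x)).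
Proof.
move=> x; set u := dirichlet_moment k s.
have u0 y : 0 < u y by exact: dirichlet_moment_gt0.
have -> : c * (a ^+ x / u x) * (c * (a ^+ x.+2 / u x.+2)) =
    (c * a ^+ x.+1) ^+ 2 / (u x * u x.+2).
  by rewrite !exprS; field; rewrite !gt_eqF.
have -> : (c * (a ^+ x.+1 / u x.+1)) ^+ 2 = (c * a ^+ x.+1) ^+ 2 / u x.+1 ^+ 2.
  by field; rewrite gt_eqF.
rewrite ler_pM2l ?exprn_gt0 ?mulr_gt0 ?exprn_gt0//.
have D_gt0 : 0 < u x * u x.+2 by exact: mulr_gt0 (u0 _) (u0 _).
rewrite lef_pV2 ?posrE ?exprn_gt0//.
exact: dirichlet_moment_log_convex.
Qed.

End pmf_ratio.

(** * The recurrence of the Gamma function *)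

Section gamma_recurrence.
Context {R : realType}.
Implicit Types a t k p : R.
Local Notation mu := (@lebesgue_measure R).

(** The exponential beats the power [a + 1]: raise [1 + t / (a + 1) <=
expR (t / (a + 1))] to the power [a + 1]. It makes the boundary term at infinity
vanish. *)
Lemma powR_expRN_le a t : 0 < a -> 0 < t ->
  t `^ a * expR (- t) <= (a + 1) `^ (a + 1) * t^-1.
Proof.
move=> a0 t0; have a1 : 0 < a + 1 by rewrite addr_gt0.
rewrite expRN ler_pdivrMr ?expR_gt0// mulrAC ler_pdivlMr// mulrC.
have -> : t * t `^ a = (a + 1) `^ (a + 1) * (t / (a + 1)) `^ (a + 1).
  rewrite -powRM ?divr_ge0 ?ltW// mulrCA divff ?gt_eqF// mulr1.
  rewrite addrC powRD ?powRr1 ?ltW//.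
  by rewrite (gt_eqF t0) implybT.
rewrite ler_pM2l ?powR_gt0//.
have -> : expR t = expR (t / (a + 1)) `^ (a + 1) by rewrite -expRM divfK ?gt_eqF.
apply: ge0_ler_powR; rewrite ?nnegrE ?expR_ge0//; first exact: ltW.
  by rewrite divr_ge0// ltW.
by apply: le_trans (expR_ge1Dx _); rewrite lerDr.
Qed.



Lemma is_derive_expRN t : is_derive t 1 (fun u => - expR (- u)) (expR (- t)).
Proof.
by apply: is_derive_eq; rewrite mulrN1 opprK.
Qed.

Let integrand_ge0 (a t : R) : 0 <= t `^ (a - 1) * expR (- t).
Proof. by rewrite mulr_ge0 ?powR_ge0 ?expR_ge0. Qed.

Let seg (n : nat) : set R := `[n.+2%:R^-1, n.+2%:R]%classic.

Let seg_gt0 n t : seg n t -> 0 < t.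
Proof. by rewrite /seg/= in_itv/= => /andP[+ _]; apply: lt_le_trans. Qed.

Let bigcup_seg : \bigcup_n seg n = `]0, +oo[%classic.
Proof.
apply/seteqP; split=> [t [n _ /seg_gt0]|t]/=; rewrite in_itv/= andbT// => t0.
pose n := Num.truncn (t + t^-1).
have h : t + t^-1 <= n.+2%:R.
  by rewrite (le_trans (ltW (truncnS_gt _)))// ler_nat.
exists n => //; rewrite /seg/= in_itv/=; apply/andP; split.
  rewrite invf_ple ?posrE//; apply: le_trans h; rewrite lerDr ltW//.
by apply: le_trans h; rewrite lerDl invr_ge0 ltW.
Qed.

Let nd_seg : nondecreasing_seq seg.
Proof.
apply/nondecreasing_seqP => n; rewrite subsetEset => t; rewrite /seg/= !in_itv/=.
move=> /andP[h1 h2]; apply/andP; split.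
  by apply: le_trans h1; rewrite lef_pV2 ?posrE// ler_nat.
by rewrite (le_trans h2)// ler_nat.
Qed.

Let seg_by_parts a n : 0 < a ->
  (\int[mu]_(t in seg n) (t `^ a * expR (- t))%:E =
  (n.+2%:R^-1 `^ a * expR (- n.+2%:R^-1) - n.+2%:R `^ a * expR (- n.+2%:R))%:E
  + a%:E * \int[mu]_(t in seg n) (t `^ (a - 1) * expR (- t))%:E)%E.
Proof.
move=> a0; set u : R := n.+2%:R^-1; set v : R := n.+2%:R.
have u0 : 0 < u by rewrite invr_gt0.
have uv : u < v by rewrite /u /v (@lt_trans _ _ 1) ?invf_lt1// ltr1n.
have dpow b : {in `]0, +oo[, forall t, derivable (@powR R ^~ b) t 1}.
  exact: derivable_powR.
have cpow b : {within `[u, v], continuous (@powR R ^~ b)}.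
  apply: derivable_within_continuous => t; rewrite in_itv/= => /andP[ut _].
  by apply: dpow; rewrite in_itv/= andbT (lt_le_trans u0).
have cexp : {within `[u, v], continuous (fun t : R => expR (- t))}.
  apply: continuous_subspaceT => t; apply: continuous_comp; last exact: continuous_expR.
  exact: opp_continuous.
have dexp t : derivable (fun u => - expR (- u)) t 1.
  exact: (@ex_derive _ _ _ _ _ _ _ (is_derive_expRN t)).
have cnexp : continuous (fun t : R => - expR (- t)).
  by move=> t; apply/differentiable_continuous; rewrite -derivable1_diffP.
rewrite (@integration_by_parts _ (@powR R ^~ a) (fun t => - expR (- t))
   (fun t => a * t `^ (a - 1)) (fun t => expR (- t)))//; first last.
- by move=> t _; rewrite derive1E; exact: (@derive_val _ _ _ _ _ _ _ (is_derive_expRN t)).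
- split; first by move=> t _; exact: dexp.
  + exact/cvg_at_right_filter/cnexp.
  + exact/cvg_at_left_filter/cnexp.
- move=> t; rewrite in_itv/= => /andP[ut _]; rewrite powR_derive1// in_itv/= andbT.
  exact: lt_trans ut.
- apply: (derivable_oy_continuousWoo uv (ltW u0)); split; first exact: dpow.
  by rewrite powR0 ?gt_eqF//; exact: powR_cvg0.
- by move=> t; apply: cvgM; [exact: cvg_cst|exact: cpow].
have -> : (\int[mu]_(t in `[u, v]) (a * t `^ (a - 1) * - expR (- t))%:E =
    (- a)%:E * \int[mu]_(t in `[u, v]) (t `^ (a - 1) * expR (- t))%:E)%E.
  rewrite -integralZl//; last first.
    apply: continuous_compact_integrable; first exact: segment_compact.
    by move=> t; apply: cvgM; [exact: cpow|exact: cexp].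
  by apply: eq_integral => t _; rewrite -EFinM; congr EFin; ring.
by rewrite EFinN mulNe oppeK !mulrN opprK [in X in X%:E]addrC.
Qed.

Let harmonicS_cvg0 : (n.+2%:R^-1 : R) @[n --> \oo] --> (0 : R).
Proof. by have := @cvg_harmonic R; rewrite -(cvg_shiftS _). Qed.

Let boundary_cvg0 a : 0 < a ->
  n.+2%:R^-1 `^ a * expR (- n.+2%:R^-1) - n.+2%:R `^ a * expR (- n.+2%:R)
  @[n --> \oo] --> (0 : R).
Proof.
move=> a0; rewrite -[0]subr0; apply: cvgB.
  have c0 : (n.+2%:R^-1 : R) `^ a @[n --> \oo] --> (0 : R).
    by move/cvg_at_rightP : (powR_cvg0 a0); apply.
  apply: (squeeze_cvgr _ (@cvg_cst _ _ _ _ _) c0); apply: nearW => n.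
  by rewrite mulr_ge0 ?powR_ge0 ?expR_ge0//= ler_piMr ?powR_ge0// expR_le1 oppr_le0.
have c0 : ((a + 1) `^ (a + 1) * (n.+2%:R^-1 : R)) @[n --> \oo] --> (0 : R).
  by rewrite -[X in _ --> X](mulr0 ((a + 1) `^ (a + 1))); exact: cvgMl_tmp.
apply: (squeeze_cvgr _ (@cvg_cst _ _ _ _ _) c0); apply: nearW => n.
by rewrite mulr_ge0 ?powR_ge0 ?expR_ge0//= powR_expRN_le.
Qed.

Let seg_cvg a : (\int[mu]_(t in seg n) (t `^ (a - 1) * expR (- t))%:E @[n --> \oo]
  --> \int[mu]_(t in `]0%R, +oo[) (t `^ (a - 1) * expR (- t))%:E)%E.
Proof.
rewrite -bigcup_seg; apply: ge0_nondecreasing_set_cvg_integral => //.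
- by move=> n; exact: measurable_itv.
- move=> n; apply/measurable_EFinP; apply: measurable_funTS.
  apply: measurable_funM; first exact: measurable_powR.
  by apply: measurableT_comp.
- by move=> n t _; rewrite lee_fin.
Qed.

(** Integration by parts on the segments [[1 / (n + 2), n + 2]], where every
function involved is smooth, followed by monotone convergence as the segments
exhaust the half-line. *)
Lemma GammaS a : 0 < a -> Gamma (a + 1) = a * Gamma a.
Proof.
move=> a0; rewrite /Gamma /Rintegral.
have -> : (\int[mu]_(t in `]0%R, +oo[) (t `^ (a + 1 - 1) * expR (- t))%:E =
  a%:E * \int[mu]_(t in `]0%R, +oo[) (t `^ (a - 1) * expR (- t))%:E)%E.
  have := @seg_cvg (a + 1); rewrite addrK.
  under eq_cvg do rewrite seg_by_parts//.
  move=> /cvg_unique; apply => //.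
  rewrite -[(a%:E * _)%E]add0e; apply: cvgeD => //.
    by apply: cvg_EFin; [exact: nearW|exact: boundary_cvg0].
  by apply: cvgeZl => //; exact: seg_cvg.
(* The identity of extended integrals survives [fine] also at [+oo], which
   [fine] sends to 0 on both sides. *)
case: (\int[mu]_(t in _) _)%E => [x||]//=.
  by rewrite mulry gtr0_sg// mul1e mulr0.
by rewrite mulrNy gtr0_sg// mul1e mulr0.
Qed.

Lemma Gamma_rising k x : 0 < k -> Gamma (k + x%:R) = Gamma k * rising k x.
Proof.
move=> k0; elim: x => [|x IHx]; first by rewrite addr0 rising0 mulr1.
by rewrite -natr1 addrA GammaS ?IHx ?risingS ?ltr_wpDr//; ring.
Qed.

Lemma nbinom_pmfE k p x : 0 < k -> Gamma k != 0 ->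
  nbinom_pmf k p x = p `^ k * (rising k x / x`!%:R * (1 - p) ^+ x).
Proof.
move=> k0 G0; rewrite /nbinom_pmf /nbinom_coef Gamma_rising//.
by field; rewrite G0 fact_neq0.
Qed.

End gamma_recurrence.

(** * Laws carried by the natural numbers *)

Section natural_valued_variables.
Context d (T : measurableType d) (R : realType) (P : probability T R).
Implicit Types Y : {RV P >-> R}.

Definition nat_valued Y : Prop := {ae P, forall w, exists m : nat, Y w = m%:R}.

Lemma ae_iff_measure (A B : set T) : measurable A -> measurable B ->
  {ae P, forall w, A w <-> B w} -> P A = P B.
Proof.
move=> mA mB [N [mN N0 sN]].
have AB w : ~ N w -> A w <-> B w by move=> Nw; apply: contrapT => /sN.
have le C D : measurable C -> measurable D -> (forall w, ~ N w -> C w -> D w) ->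
    (P C <= P D)%E.
  move=> mC mD CD; rewrite -(measureU0 mD mN N0); apply: le_measure.
  - by rewrite inE.
  - by rewrite inE; exact: measurableU.
  - by move=> w Cw; have [Nw|Nw] := pselect (N w); [right|left; exact: CD].
by apply/eqP; rewrite eq_le !le// => w /AB[].
Qed.

Lemma measure_bigcup_pred (I : finType) (D : pred I) (F : I -> set T) :
  (forall i, measurable (F i)) -> trivIset setT F ->
  P (\bigcup_(i in [set` D]) F i) = (\sum_(i | D i) P (F i))%E.
Proof.
move=> mF tF; rewrite measure_fin_bigcup//; last exact: sub_trivIset tF.
by rewrite [RHS]bigfs ?index_enum_uniq// => i _; rewrite mem_index_enum.
Qed.

Lemma measurable_RV_preimage Y (A : set R) :
  measurable A -> measurable (Y @^-1` A).
Proof. by move=> mA; rewrite -[X in measurable X]setTI; exact: measurable_funP. Qed.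

Lemma pmf_fineK Y (r : R) : (pmf Y r)%:E = P (Y @^-1` [set r]).
Proof.
by rewrite /pmf fineK// fin_num_measure//; exact: measurable_RV_preimage.
Qed.

Lemma distribution_partial_sum Y (A : set R) (m : nat) :
  nat_valued Y -> measurable A -> (forall j : nat, A j%:R <-> (j < m)%N) ->
  distribution P Y A = (partial_sum (fun x => pmf Y x%:R) m)%:E.
Proof.
move=> natY mA Am; pose F (j : 'I_m) := Y @^-1` [set (j%:R : R)].
have mF j : measurable (F j) by exact: measurable_RV_preimage.
rewrite /partial_sum -sumEFin; under eq_bigr do rewrite pmf_fineK.
rewrite -(@measure_bigcup_pred _ xpredT F)//; last first.
  apply/trivIsetP => i j _ _ ij; apply/seteqP; split=> // w []; rewrite /F/= => -> /eqP.
  by rewrite eqr_nat => /eqP/val_inj/eqP; rewrite (negbTE ij).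
apply: ae_iff_measure.
- exact: measurable_RV_preimage.
- by apply: fin_bigcup_measurable.
apply: filterS natY => w [i Yi]; rewrite /preimage/= Yi Am.
split=> [im|[j _]]; first by exists (Ordinal im).
by rewrite /F/= => /eqP; rewrite Yi eqr_nat => /eqP ->.
Qed.

Lemma cdf_nat Y (n : nat) : nat_valued Y ->
  cdf Y n%:R = (partial_sum (fun x => pmf Y x%:R) n.+1)%:E.
Proof.
by move=> natY; apply: distribution_partial_sum => // j; rewrite /= in_itv/= ler_nat.
Qed.

Lemma cdf_real Y (x : R) : nat_valued Y ->
  cdf Y x = (partial_sum (fun x => pmf Y x%:R)
               (if 0 <= x then (Num.truncn x).+1 else 0%N))%:E.
Proof.
move=> natY; apply: distribution_partial_sum => // j; rewrite /= in_itv/=.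
case: ifPn => [x0|]; last first.
  by rewrite -ltNge => x0; rewrite leNgt (lt_le_trans x0).
by rewrite ltnS -truncn_ge_nat.
Qed.

Lemma nat_valued_cvg Y : nat_valued Y ->
  partial_sum (fun x => pmf Y x%:R) @ \oo --> (1 : R).
Proof.
move=> natY; rewrite -cvg_shiftS.
have /fine_cvg := cvg_comp _ _ (@cvgr_idn R) (cvg_cdfy1 Y).
apply: cvg_trans; apply: near_eq_cvg; apply: nearW => n /=.
by rewrite cdf_nat.
Qed.

Lemma fine_ccdf_nat Y (n : nat) : nat_valued Y ->
  fine (ccdf Y n%:R) = 1 - partial_sum (fun x => pmf Y x%:R) n.+1.
Proof. by move=> natY; rewrite ccdf_1_cdf cdf_nat. Qed.

End natural_valued_variables.

(** Real thresholds reduce to natural ones: the distribution function of a variable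
with values in the natural numbers only sees the integer part. *)
Lemma st_leP d d' (T : measurableType d) (T' : measurableType d') (R : realType)
    (P : probability T R) (P' : probability T' R)
    (X : {RV P >-> R}) (Y : {RV P' >-> R}) : nat_valued X -> nat_valued Y ->
  st_le X Y <-> (forall n, partial_sum (fun x => pmf Y x%:R) n <=
                           partial_sum (fun x => pmf X x%:R) n).
Proof.
move=> natX natY; split=> [XY [|n]|XY x].
- by rewrite /partial_sum !big_ord0.
- have := XY n%:R; rewrite !ccdf_1_cdf !cdf_nat// -!EFinB lee_fin.
  by rewrite lerD2l lerN2.
- by rewrite !ccdf_1_cdf !cdf_real// -!EFinB lee_fin lerD2l lerN2.
Qed.

Section negative_binomial_law.
Context d (T : measurableType d) (R : realType) (P : probability T R).
Implicit Types Y : {RV P >-> R}.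

(** Were [Gamma k] zero, dividing by it would make every mass zero, whereas the
total mass is one. *)
Lemma nbinom_law_Gamma_neq0 Y (k p : R) : nbinom_law Y k p -> Gamma k != 0.
Proof.
move=> /(_ setT measurableT); rewrite probability_setT => total.
apply/eqP => G0; move/eqP: total; rewrite /nbinom_prob esum1 ?onee_eq0//.
move=> x _; rewrite /nbinom_pmf /nbinom_coef G0 mul0r invr0 mulr0 !mul0r.
by [].
Qed.

Lemma nbinom_law_pmf Y (k p : R) x : 0 < k -> 0 < p < 1 -> nbinom_law Y k p ->
  pmf Y x%:R = p `^ k * (rising k x / x`!%:R * (1 - p) ^+ x).
Proof.
move=> k0 /andP[p0 p1] lawY; have G0 := nbinom_law_Gamma_neq0 lawY.
have := lawY [set x%:R] (measurable_set1 _).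
have -> : [set y : nat | [set x%:R : R] y%:R] = [set x].
  by apply/seteqP; split=> y /= => [/eqP|->//]; rewrite eqr_nat => /eqP.
rewrite /nbinom_prob esum_set1 nbinom_pmfE//; last first.
  rewrite lee_fin !mulr_ge0 ?powR_ge0 ?invr_ge0 ?exprn_ge0 ?subr_ge0 ?(ltW p1)//.
  by rewrite ltW// rising_gt0.
by rewrite /distribution/pushforward /pmf => ->.
Qed.

Lemma nbinom_law_nat_valued Y (k p : R) : nbinom_law Y k p -> nat_valued Y.
Proof.
move=> lawY; pose N := range (fun m : nat => m%:R : R).
have mN : measurable N by apply: countable_measurable => [r|]; [exact: measurable_set1|exact: card_image_le].
have PN : distribution P Y N = 1%E.
  rewrite lawY//.
  have -> : [set x : nat | N x%:R] = [set x : nat | [set: R] x%:R].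
    by apply/seteqP; split=> // x _; exists x.
  by rewrite -lawY// probability_setT.
exists (Y @^-1` (~` N)); split.
- by apply: measurable_RV_preimage; exact: measurableC.
- by have := probability_setC P (measurable_RV_preimage Y mN); rewrite preimage_setC [P (Y @^-1` N)]PN subee.
- by move=> w /= Yw [m _ mY]; apply: Yw; exists m.
Qed.

End negative_binomial_law.

Section sum_of_independent.
Context d (T : measurableType d) (R : realType) (P : probability T R) (n : nat).
Variable X : 'I_n -> {RV P >-> R}.
Hypotheses (X_indep : mutually_independent X) (X_nat : forall i, nat_valued (X i)).

Let N : {RV P >-> R} := (\sum_(i < n) (X i : {mfun T >-> R}))%R.

Lemma RV_sumE w : N w = \sum_i X i w.
Proof. by rewrite /N; elim/big_rec2: _ => //= i y1 y2 _ <-. Qed.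

Lemma ae_all_nat : {ae P, forall w, forall i, exists m : nat, X i w = m%:R}.
Proof. by apply: filter_forall. Qed.

Lemma sum_nat_valued : nat_valued N.
Proof.
apply: filterS ae_all_nat => w /choice[m Xm]; exists (\sum_i m i)%N.
by rewrite RV_sumE natr_sum; apply: eq_bigr.
Qed.

(** The event that the sum equals [x] is, up to a null set, the disjoint union
over the multi-indices [t] of sum [x] of the events that [X i = t i] for every
[i]. Entries of [t] cannot exceed [x], hence the finite type. *)
Lemma pmf_sum (x : nat) : pmf N x%:R =
  \sum_(t : {ffun 'I_n -> 'I_x.+1} | (\sum_i t i)%N == x)
    \prod_i pmf (X i) (t i)%:R.
Proof.
pose F (t : {ffun 'I_n -> 'I_x.+1}) : set T :=
  \bigcap_(i in [set` [set: 'I_n]%SET]) (X i @^-1` [set ((t i)%:R : R)]).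
have PF t : P (F t) = (\prod_i pmf (X i) (t i)%:R)%:E.
  rewrite X_indep// -prodEFin.
  rewrite (eq_bigl xpredT) => [|i]; last by rewrite inE.
  by apply: eq_bigr => i _; rewrite pmf_fineK.
have mF t : measurable (F t).
  apply: fin_bigcap_measurable; first by [].
  by move=> i _; apply: measurable_RV_preimage; exact: measurable_set1.
have tF : trivIset setT F.
  apply/trivIsetP => t t' _ _ tt'; apply/seteqP; split=> // w [Ft Ft'].
  move/eqP: tt'; apply; apply/ffunP => i; apply: val_inj; apply/eqP.
  have Xt : X i w = (t i)%:R by apply: Ft; rewrite /= inE.
  have Xt' : X i w = (t' i)%:R by apply: Ft'; rewrite /= inE.
  by rewrite /= -(eqr_nat R) -Xt -Xt'.
suff : P (N @^-1` [set x%:R]) =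
    P (\bigcup_(t in [set` [pred t : {ffun 'I_n -> 'I_x.+1} | (\sum_i t i)%N == x]]) F t).
  rewrite measure_bigcup_pred// -pmf_fineK; under eq_bigr do rewrite PF.
  by rewrite sumEFin => -[].
apply: ae_iff_measure.
- by apply: measurable_RV_preimage; exact: measurable_set1.
- by apply: fin_bigcup_measurable.
apply: filterS ae_all_nat => w /choice[m Xm]; rewrite /preimage/= RV_sumE.
have -> : \sum_i X i w = (\sum_i m i)%N%:R.
  by rewrite natr_sum; apply: eq_bigr.
split=> [/eqP|[t /= /eqP tx Ft]].
  rewrite eqr_nat => /eqP mx.
  have mi i : (m i < x.+1)%N by rewrite ltnS -mx (bigD1 i)//= leq_addr.
  exists [ffun i => Ordinal (mi i)] => /=.
    by apply/eqP; rewrite -[RHS]mx; apply: eq_bigr => i _; rewrite ffunE.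
  by move=> i _; rewrite /= ffunE Xm.
rewrite -tx; congr (_%:R); apply: eq_bigr => i _.
have /eqP : X i w = (t i)%:R by apply: Ft; rewrite /= inE.
by rewrite Xm eqr_nat => /eqP.
Qed.

End sum_of_independent.

(** * Comparison of the two laws *)

Theorem theorem5 (R : realType) (n : nat) (k q : 'I_n -> R) (p : R)
    (d : measure_display) (T : measurableType d) (P : probability T R)
    (X : 'I_n -> {RV P >-> R})
    (d' : measure_display) (T' : measurableType d') (P' : probability T' R)
    (M : {RV P' >-> R})
    (n_ge1 : (1 <= n)%N)
    (k_gt0 : forall i, 0 < k i)
    (q01 : forall i, 0 < q i < 1)
    (p01 : 0 < p < 1)
    (X_indep : mutually_independent X)
    (X_law : forall i, nbinom_law (X i) (k i) (q i))
    (M_law : nbinom_law M (\sum_(i < n) k i) p) :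
  let kplus := \sum_(i < n) k i in
  let N : {RV P >-> R} := (\sum_(i < n) (X i : {mfun T >-> R}))%R in
  ((st_le M N <-> (\prod_(i < n) q i `^ k i) `^ (1 / kplus) <= p) /\
   (hr_le M N <-> (\prod_(i < n) q i `^ k i) `^ (1 / kplus) <= p)) /\
  ((lr_le M N <-> (\sum_(i < n) k i * q i) / kplus <= p) /\
   (rh_le M N <-> (\sum_(i < n) k i * q i) / kplus <= p)).
Proof.
move=> K N.
have K_gt0 : 0 < K by exact: sum_gt0.
have [p_gt0 p_lt1] := andP p01.
have q_gt0 i : 0 < q i by have /andP[] := q01 i.
pose s i := 1 - q i.
have s_gt0 i : 0 < s i by rewrite subr_gt0; have /andP[] := q01 i.
have pc_gt0 : 0 < 1 - p by rewrite subr_gt0.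
pose Q := \prod_(i < n) q i `^ k i.
have Q_gt0 : 0 < Q by apply: prodr_gt0 => i _; exact: powR_gt0.
have X_nat i : nat_valued (X i) := nbinom_law_nat_valued (X_law i).
have M_nat : nat_valued M := nbinom_law_nat_valued M_law.
have N_nat : nat_valued N by exact: sum_nat_valued.
pose f x := pmf M x%:R; pose g x := pmf N x%:R.
pose w x := rising K x / x`!%:R.
have w_gt0 x : 0 < w x by rewrite divr_gt0 ?rising_gt0// ltr0n fact_gt0.
have fE x : f x = p `^ K * (w x * (1 - p) ^+ x) by exact: nbinom_law_pmf.
have gE x : g x = Q * (w x * dirichlet_moment k s x).
  rewrite /dirichlet_moment mulrC -/K -/(w x) [w x * _]mulrC divfK ?gt_eqF// mulrC.
  rewrite nbinom_convE /g pmf_sum// mulr_sumr; apply: eq_bigr => t _.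
  rewrite -big_split; apply: eq_bigr => i _ /=.
  exact: (nbinom_law_pmf _ (k_gt0 i) (q01 i) (X_law i)).
have f_gt0 x : 0 < f x.
  rewrite fE; apply: mulr_gt0; first exact: powR_gt0.
  by apply: mulr_gt0 => //; exact: exprn_gt0.
have U_gt0 x : 0 < dirichlet_moment k s x by exact: dirichlet_moment_gt0.
have g_gt0 x : 0 < g x.
  by rewrite gE; apply: mulr_gt0 => //; exact: mulr_gt0 (w_gt0 x) (U_gt0 x).
(* The moments are free of [p]: only the powers of [1 - p] depend on it. *)
have rE x : f x / g x = p `^ K / Q * ((1 - p) ^+ x / dirichlet_moment k s x).
  by rewrite fE gE; field; rewrite !gt_eqF.
have r_lc : log_concave (fun x => f x / g x).
  move=> x; rewrite !rE; apply: geometric_div_moment_log_concave => //.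
  by rewrite divr_gt0 ?powR_gt0.
have f_sum1 : partial_sum f @ \oo --> (1 : R) by exact: nat_valued_cvg.
have g_sum1 : partial_sum g @ \oo --> (1 : R) by exact: nat_valued_cvg.
have mass0 : g 0%N <= f 0%N <-> Q `^ (1 / K) <= p.
  have -> : g 0%N = Q.
    by rewrite gE /w rising0 fact0 dirichlet_moment0 divr1 !mulr1.
  have -> : f 0%N = p `^ K by rewrite fE /w rising0 fact0 divr1 !mulr1.
  have K_inv : K * (1 / K) = 1 by rewrite div1r divff ?gt_eqF.
  have powRK a : 0 < a -> (a `^ K) `^ (1 / K) = a.
    by move=> a0; rewrite -powRrM K_inv powRr1// ltW.
  have powRVK a : 0 < a -> (a `^ (1 / K)) `^ K = a.
    by move=> a0; rewrite -powRrM mulrC K_inv powRr1// ltW.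
  split=> Qp.
    rewrite -(powRK p)//; apply: ge0_ler_powR => //; rewrite ?nnegrE ?powR_ge0//.
      by rewrite divr_ge0// ltW.
    exact: ltW.
  rewrite -(powRVK Q)//.
  by apply: ge0_ler_powR => //; rewrite ?nnegrE ?powR_ge0// ltW.
have ratio01 : f 1%N / g 1%N <= f 0%N / g 0%N <-> (\sum_(i < n) k i * q i) / K <= p.
  rewrite !rE dirichlet_moment0 dirichlet_moment1// -/K expr0 expr1 divr1 mulr1.
  rewrite -[in leRHS](mulr1 (p `^ K / Q)) ler_pM2l ?divr_gt0 ?powR_gt0//.
  have -> : \sum_i k i * s i = K - \sum_i k i * q i.
    by rewrite -sumrB; apply: eq_bigr => i _; rewrite mulrBr mulr1.
  have <- : 1 - (\sum_i k i * q i) / K = (K - \sum_i k i * q i) / K.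
    by rewrite mulrBl divff ?gt_eqF.
  have S_gt0 : 0 < 1 - (\sum_i k i * q i) / K.
    rewrite subr_gt0 ltr_pdivrMr// mul1r -subr_gt0 -sumrB.
    apply: (@sum_gt0 _ _ (fun i => k i - k i * q i)) => // i.
    by rewrite -{1}(mulr1 (k i)) -mulrBr; exact: mulr_gt0 (k_gt0 i) (s_gt0 i).
  by rewrite ler_pdivrMr// mul1r lerD2l lerN2.
split; split.
- by rewrite st_leP// -mass0; exact: st_iff_mass0.
- rewrite -mass0 -(hr_iff_mass0 f_gt0 g_gt0 f_sum1 g_sum1 r_lc) /hr_le.
  by split=> H x; have := H x; rewrite !fine_ccdf_nat.
- by rewrite -ratio01; exact: (lr_iff_ratio01 f_gt0 g_gt0 r_lc).
- rewrite -ratio01 -(rh_iff_ratio01 f_gt0 g_gt0 r_lc) /rh_le.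
  by split=> H x; have := H x; rewrite !cdf_nat.
Qed.
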